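(* Let $F$ be a finite field with $|F|=q$, and let $V$ be a vector space over $F$ with $\dim(V)=n\geq 2$. Then $\gamma(G(V))=q+1$.
   Context: For a finite-dimensional vector space $V$ over a finite field, the intersection graph of subspaces $G(V)$ is the simple graph whose vertices are the proper nontrivial subspaces of $V$ (i.e. subspaces $W$ with $W\neq 0$ and $W\neq V$), two distinct vertices being adjacent if and only if the corresponding subspaces have nonzero intersection. A set $S$ of vertices of a graph $G$ is a dominating set if every vertex of $G$ is in $S$ or adjacent to a vertex of $S$ (i.e. $N[S]=V(G)$). The domination number $\gamma(G)$ is the minimum cardinality of a dominating set of $G$. *)

(* Defs.v *)
From HB Require Import structures.
From mathcomp Require Import all_boot all_order all_algebra.

Set Implicit Arguments.
Unset Strict Implicit.
Unset Printing Implicit Defensive.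

Record sgraph := SGraph {
  vertex :> finType;
  adj : rel vertex;
  adj_sym : symmetric adj;
  adj_irrefl : irreflexive adj
}.

Section Domination.
Variable G : sgraph.
Implicit Type S : {set G}.

Definition closed_nbhd S : {set G} :=
  S :|: [set v | [exists u in S, adj u v]].

Definition dominating S : bool := closed_nbhd S == [set: G].

Lemma dominatingT : dominating [set: G].
Proof. by rewrite /dominating /closed_nbhd setTU. Qed.

(* By dominatingT the seed [set: G] is admissible, so the arg min is a genuine
   minimum. *)
Definition domination_number : nat :=
  #|[arg min_(S < [set: G] | dominating S) #|S| ]|.

End Domination.

Section SubspaceFinite.
Variables (F : finFieldType) (V : vectType F).

(* The canonical-matrix encoding of {vspace V} is used only to derive that there
   are finitely many subspaces. *)
Import VectorInternalTheory.

HB.instance Definition _ := [Countable of {vspace V} by <:].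
HB.instance Definition _ := [Finite of {vspace V} by <:].

End SubspaceFinite.

Section SubspaceGraph.
Variables (F : finFieldType) (V : vectType F).

Definition proper_nontrivial : pred {vspace V} :=
  [pred W | (W != 0%VS) && (W != fullv)].

Definition subspace_adj : rel {W : {vspace V} | proper_nontrivial W} :=
  [rel W1 W2 | (W1 != W2) && ((val W1 :&: val W2)%VS != 0%VS)].

Lemma subspace_adj_sym : symmetric subspace_adj.
Proof. by move=> W1 W2; rewrite /subspace_adj /= eq_sym capvC. Qed.

Lemma subspace_adj_irrefl : irreflexive subspace_adj.
Proof. by move=> W; rewrite /subspace_adj /= eqxx. Qed.

Definition subspace_graph : sgraph :=
  SGraph subspace_adj_sym subspace_adj_irrefl.

End SubspaceGraph.

(* Main.v *)
Require Import Defs.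
From mathcomp Require Import all_boot all_order all_algebra.
From mathcomp Require Import finfield zify.

Set Implicit Arguments.
Unset Strict Implicit.
Unset Printing Implicit Defensive.

Import GRing.Theory.

(** A proper nontrivial subspace meets itself, so a set of vertices dominates
    as soon as each vertex meets one of its members nontrivially, whether or
    not the two are distinct.  When [\dim V >= 2] the lines are vertices, and a
    line meets [W] nontrivially exactly when it lies in [W]: hence the dominating
    sets are exactly the families of proper nontrivial subspaces that cover [V]
    ([dominatingP]), and [theorem11] asks how few such subspaces can do so.

    Fewer than [q + 1] never suffice ([card_subspace_cover]): a proper subspace
    has at most [q ^ n.-1 - 1] nonzero vectors, and [q] times that number is
    [q ^ n - q], short of the [q ^ n - 1] nonzero vectors of [V].

    Conversely, the [q + 1] hyperplanes through a subspace of codimension [2]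
    cover [V] ([pencil_cover]).  They are obtained as a pencil, the kernels of
    [g] and of [f - a g] for scalars [a], where [f] and [g] are two independent
    linear forms: a vector [v] lies in [ker g] if [g v = 0], and otherwise in
    the kernel for [a = f v / g v]. *)

(** * Domination as covering by subspaces *)

Section DominatingCover.
Variables (F : finFieldType) (V : vectType F).
Implicit Types (v : V) (U W : {vspace V}).

Lemma memv_capv_line_neq0 v W : (<[v]> :&: W != 0)%VS -> v \in W.
Proof.
move=> nz; have [u /[!memv_cap] /andP[/vlineP[k ->] kvW] kv_nz] :
    exists2 u, u \in (<[v]> :&: W)%VS & u != 0%R.
  by exists (vpick (<[v]> :&: W)); rewrite ?memv_pick ?vpick0.
have k_nz : k != 0%R by apply: contraNneq kv_nz => ->; rewrite scale0r.
by rewrite rpredZeq (negPf k_nz) in kvW.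
Qed.

Lemma proper_nontrivial_line v :
  1 < \dim {:V} -> v != 0%R -> proper_nontrivial <[v]>%VS.
Proof.
move=> dimV v_nz; rewrite /proper_nontrivial /= -dimv_eq0 dim_vline v_nz /=.
by apply: contraTneq dimV => <-; rewrite dim_vline v_nz.
Qed.

(** Only nonzero vectors are asked to be covered because they are the ones that
    span vertices. *)
Lemma dominatingP (S : {set subspace_graph V}) : 1 < \dim {:V} ->
  reflect (forall v, v != 0%R -> exists2 W, W \in S & v \in val W)
          (dominating S).
Proof.
move=> dimV; apply: (iffP eqP) => [domS v v_nz | covS].
  have: Sub _ (proper_nontrivial_line dimV v_nz) \in closed_nbhd S.
    by rewrite domS inE.
  rewrite !inE => /orP[LS | /existsP[W /and3P[WS _ meetWL]]].
    by eexists; first exact: LS; rewrite /= memv_line.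
  by exists W => //; apply: memv_capv_line_neq0; rewrite capvC.
apply/setP => U; rewrite !inE.
have /andP[U_nz _] := valP U.
have [|W WS uW] := covS (vpick (val U)); first by rewrite vpick0.
have [-> | neqWU] := eqVneq U W; first by rewrite WS.
apply/orP; right; apply/existsP; exists W; rewrite WS /= /subspace_adj /=.
rewrite eq_sym neqWU /=; apply: contraTneq U_nz => capWU0.
by rewrite negbK -vpick0 -memv0 -capWU0 memv_cap uW memv_pick.
Qed.

End DominatingCover.

(** * The lower bound *)

Section LowerBound.
Variables (F : finFieldType) (V : vectType F).

Lemma card_nonzero_vectors (U : {vspace V}) :
  #|[set v : finvect_type V | (v != 0%R) && (v \in U)]| = (#|F| ^ \dim U).-1.
Proof.
pose A := [pred v : finvect_type V | v \in U].
have <- : #|A| = #|F| ^ \dim U.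
  (* Destructing [V] makes [finvect_type V] and [V] share their structure of
     vector space up to conversion. *)
  by case: V U @A => T cT U; apply: (card_vspace (T := finvect_type _)).
have A0 : (0%R : finvect_type V) \in A by apply: mem0v.
rewrite (cardD1 (0%R : finvect_type V) A) A0 /=.
by apply: eq_card => v; rewrite !inE.
Qed.

(** Counting nonzero vectors, rather than all of them, gives the sharp bound:
    the zero vector lies in every subspace, and a plain count would only give
    [#|F| <= #|S|]. *)
Lemma card_subspace_cover (I : finType) (S : {set I}) (U : I -> {vspace V}) :
    0 < \dim {:V} -> {in S, forall i, U i != fullv} ->
    (forall v : V, v != 0%R -> exists2 i, i \in S & v \in U i) ->
  #|F| < #|S|.
Proof.
move=> dimV properU covU; set q := #|F|; set n : nat := \dim {:V} in dimV.
have q_gt1 : 1 < q := finNzRing_gt1 F.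
pose N (W : {vspace V}) := [set v : finvect_type V | (v != 0%R) && (v \in W)].
have cardN i : i \in S -> #|N (U i)| <= (q ^ n.-1).-1.
  move=> iS; rewrite card_nonzero_vectors -/q.
  have ltU : \dim (U i) < n.
    rewrite ltn_neqAle dimvS ?subvf // andbT.
    by apply: contra (properU i iS) => /eqP eqd; rewrite eqEdim subvf eqd /=.
  by rewrite -!subn1 leq_sub2r // leq_exp2l // subn1 -ltnS prednK.
have covN : N fullv \subset \bigcup_(i in S) N (U i).
  apply/subsetP => v; rewrite inE => /andP[v_nz _].
  by have [i iS vU] := covU v v_nz; apply/bigcupP; exists i; rewrite ?inE ?v_nz.
have card_le : (q ^ n).-1 <= #|S| * (q ^ n.-1).-1.
  rewrite -card_nonzero_vectors (leq_trans (subset_leq_card covN)) //.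
  rewrite -sum_nat_const (leq_trans _ (leq_sum _ cardN)) //.
  elim/big_rec2: _ => [|i k A _ leA]; first by rewrite cards0.
  by rewrite (leq_trans (leq_card_setU _ _).1) // leq_add2l.
(* If [#|S| <= q], the right-hand side is at most [q ^ n - q]; this is less than
   [q ^ n - 1] because [1 < q]. *)
have qn : q ^ n = q * q ^ n.-1 by rewrite -expnS prednK.
have : 0 < q ^ n.-1 by rewrite expn_gt0 ltnW.
by rewrite [_ < #|S|]ltnNge => qn1_gt0; apply/negP => leSq; nia.
Qed.

End LowerBound.

(** * The upper bound *)

Section Pencil.
Variables (F : finFieldType) (V : vectType F).
Implicit Types (f g h : 'Hom(V, F^o)).

(** The index type [option F] is the projective line over [F], with [None] as
    the point at infinity. *)
Definition pencil f g (a : option F) : {vspace V} :=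
  if a is Some b then lker (f - b *: g)%R else lker g.

Lemma pencil_cover f g v : exists a, v \in pencil f g a.
Proof.
have [gv0 | gv_nz] := eqVneq (g v) 0%R; first by exists None; rewrite memv_ker gv0.
exists (Some (f v / g v)%R); rewrite memv_ker !lfun_simp.
by rewrite -[(_ *: _)%R]/(_ * _)%R divfK // subrr.
Qed.

(** The kernel of a linear form has codimension at most [1], so it cannot
    vanish in dimension at least [2]. *)
Lemma proper_nontrivial_lker h : 1 < \dim {:V} -> h != 0%R ->
  proper_nontrivial (lker h).
Proof.
move=> dimV h_nz; apply/andP; split.
  apply: contraTneq dimV => ker0; rewrite -(limg_ker_dim h) ker0 capv0 dimv0.
  by rewrite -leqNgt (leq_trans (dimvS (subvf _))) // dimvf.
apply: contraNneq h_nz => kerT; apply/eqP/lfunP => v.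
by apply/eqP; rewrite lfunE -memv_ker kerT memvf.
Qed.

(** Two forms of a dual basis are independent, so no member of their pencil is
    the zero form. *)
Lemma exists_proper_pencil : 1 < \dim {:V} ->
  exists f g, forall a, proper_nontrivial (pencil f g a).
Proof.
move=> dimV; pose X := vbasis {:V}; have freeX := basis_free (vbasisP {:V}).
pose i0 := Ordinal (ltnW dimV); pose i1 := Ordinal dimV.
pose dual i : 'Hom(V, F^o) := linfun (coord X i : V -> F^o).
have dualE i (j : 'I_(\dim {:V})) : (dual i X`_j = (j == i)%:R)%R.
  by rewrite lfunE /= coord_free.
clearbody dual.
exists (dual i0), (dual i1) => -[a|]; apply: proper_nontrivial_lker => //.
  apply/eqP => /lfunP/(_ (X`_i0)%R); rewrite !lfun_simp !dualE /=.
  by rewrite scaler0 subr0 => /eqP; rewrite oner_eq0.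
apply/eqP => /lfunP/(_ (X`_i1)%R); rewrite !lfun_simp !dualE /=.
by move/eqP; rewrite oner_eq0.
Qed.

(** Indexing the hyperplanes by [option F] bounds their number by [#|F| + 1]
    without having to know that they are distinct. *)
Lemma exists_small_dominating : 1 < \dim {:V} ->
  exists2 S : {set subspace_graph V}, dominating S & #|S| <= #|F| + 1.
Proof.
move=> dimV; have [f [g properP]] := exists_proper_pencil dimV.
pose H a : subspace_graph V := Sub (pencil f g a) (properP a).
exists [set H a | a : option F].
  apply/dominatingP => // v _; have [a va] := pencil_cover f g v.
  by exists (H a); rewrite ?imset_f.
by rewrite (leq_trans (leq_imset_card _ _)) // card_option addn1.
Qed.

End Pencil.

Theorem theorem11 (F : finFieldType) (q : nat) (hq : #|F| = q)
  (V : vectType F) (n : nat) (hV : \dim (fullv : {vspace V}) = n)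
  (hn : 2 <= n) :
  domination_number (subspace_graph V) = q + 1.
Proof.
rewrite -{}hV in hn; rewrite -{}hq /domination_number.
case: arg_minnP => [|S domS minS]; first exact: dominatingT.
apply/eqP; rewrite eqn_leq; apply/andP; split.
  have [S' domS' leS'] := exists_small_dominating hn.
  exact: leq_trans (minS _ domS') leS'.
rewrite addn1; apply: (card_subspace_cover (U := val) (ltnW hn)).
  by move=> W _; have /andP[] := valP W.
exact/dominatingP.
Qed.
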